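(* Let $A\subseteq\mathbb{R}$ be a finite set. Then \[ \left|\left\{(a_1-a_2)a_3+a_1 : a_1,a_2,a_3\in A\right\}\right| \gg |A|^{5/3}. \]
   Context: The notation $X\gg Y$ means $X\ge cY$ for an absolute constant $c>0$. *)

(* Defs.v *)
From mathcomp Require Export all_boot all_order all_algebra.
From mathcomp Require Export finmap.
From mathcomp Require Export reals exp.

Set Implicit Arguments.
Unset Strict Implicit.
Unset Printing Implicit Defensive.

Import GRing.Theory Num.Theory.

Local Open Scope fset_scope.
Local Open Scope ring_scope.

Definition expander_set (R : realType) (A : {fset R}) : {fset R} :=
  [fset (a.1.1 - a.1.2) * a.2 + a.1.1 | a : R * R * R in A `*` A `*` A].

Lemma expander_setP (R : realType) (A : {fset R}) (x : R) :
  reflect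
    (exists a1 a2 a3 : R,
      [/\ a1 \in A, a2 \in A, a3 \in A & x = (a1 - a2) * a3 + a1])
    (x \in expander_set A).
Proof.
apply: (iffP idP) => [/imfsetP[[[a1 a2] a3]] /=|[a1 [a2 [a3 [h1 h2 h3 ->]]]]].
  by rewrite !inE /= => /andP[/andP[h1 h2] h3] ->; exists a1, a2, a3.
by apply/imfsetP; exists (a1, a2, a3); rewrite //= !inE /= h1 h2 h3.
Qed.

(* Main.v *)
Require Import Defs.
From mathcomp Require Import all_boot all_order all_algebra.
From mathcomp Require Import finmap.
From mathcomp Require Import reals exp.
From mathcomp Require Import zify ring lra.

(** Let [N = |A|], let [B] be the expander set, and for [a1 <> a2] in [A] let
    [l = l_(a1, a2)] be the line [x |-> (a1 - a2) x + a1], which maps [A] into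
    [B]. By Cauchy-Schwarz, [N^6 << |B| S], where [S] counts the solutions of
    [l x = l' x'] with [x, x'] in [A]; that is, [S] sums over pairs [(l, l')]
    the number [i(g)] of points of the grid [A x A] on the line
    [g = l'^-1 l]. Let [r(g)] be the number of representations of [g] as such a
    quotient. The energy [sum_g r(g)^2] is bounded by the number of collinear
    quadruples in [A x A].

    Cutting [A x A] into [j x j] cells with about [(N / j)^2] points each, a
    line meets fewer than [2 j] cells, so [i(g) - 2 j] is at most the number
    of pairs of points on [g] sharing a cell; hence the sum of
    [(i(g) - 2 j)_+] over any finite set of lines is [<< N^4 / j^2].
    Summing this over [j] with weight [j^2] gives [sum_g r(g)^2 << N^5], and
    summing it over [j >= d] gives [sum_g ((i(g) - 2 d)_+)^2 << N^4 / d].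
    With [d] about [N^(1/3)], splitting [i(g)] at [2 d] and AM-GM yield
    [S << N^5 / d^2], that is, [|B| >> N d^2 >> N^(5/3)]. *)

Set Implicit Arguments.
Unset Strict Implicit.
Unset Printing Implicit Defensive.

Import Order.TTheory GRing.Theory Num.Theory.

(** * Fibers of a map on a finite set, and Cauchy-Schwarz *)

Section Fibers.
Local Open Scope nat_scope.
Variables (X : finType) (Y : eqType) (D : {set X}) (f : X -> Y).

Definition fiber (y : Y) : {set X} := [set x in D | f x == y].

Lemma mem_fiber (x : X) (y : Y) : (x \in fiber y) = (x \in D) && (f x == y).
Proof. by rewrite inE. Qed.

Definition values : seq Y := undup [seq f x | x in D].

Lemma sum_fiber (F : Y -> nat) :
  \sum_(x in D) F (f x) = \sum_(y <- values) #|fiber y| * F y.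
Proof.
under [RHS]eq_bigr => y _ do
  rewrite -sum1_card big_distrl big_mkcond /=.
rewrite exchange_big /= [LHS]big_mkcond; apply: eq_bigr => x _ /=.
under eq_bigr => y _ do rewrite mem_fiber mul1n.
case: ifP => [xD|_] /=; last by rewrite big1_eq.
rewrite (bigD1_seq (f x)) ?undup_uniq //=; last first.
  by rewrite mem_undup; apply/imageP; exists x.
rewrite eqxx big1 ?addn0 // => y; rewrite eq_sym => /negPf ->.
by [].
Qed.

Lemma card_sum_fiber : #|D| = \sum_(y <- values) #|fiber y|.
Proof.
rewrite -sum1_card (sum_fiber (fun=> 1)).
by apply: eq_bigr => y _; rewrite muln1.
Qed.

(** The sum on the right is that of the squared fiber sizes. Doubled, both sides are sums over pairs
    of values, compared termwise by [2 a b <= a^2 + b^2]. *)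
Lemma fiber_CauchySchwarz :
  #|D| ^ 2 <= size values * \sum_(x in D) #|fiber (f x)|.
Proof.
rewrite (sum_fiber (fun y => #|fiber y|)) card_sum_fiber.
set r := fun y => #|fiber y|.
rewrite -(leq_pmul2l (isT : 0 < 2)).
have -> : 2 * (\sum_(y <- values) r y) ^ 2 =
    \sum_(y <- values) \sum_(z <- values) 2 * (r y * r z).
  rewrite -mulnn big_distrl big_distrr /=.
  by apply: eq_bigr => y _; rewrite big_distrr /= big_distrr.
have -> : 2 * (size values * \sum_(y <- values) r y * r y) =
    \sum_(y <- values) \sum_(z <- values) (r y ^ 2 + r z ^ 2).
  under [RHS]eq_bigr => y _ do
    rewrite big_split /= big_const_seq count_predT iter_addn_0.
  rewrite big_split /= big_const_seq count_predT iter_addn_0 -big_distrl /=.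
  under [\sum_(y <- _) _ ^ 2]eq_bigr => y _ do rewrite -mulnn.
  by rewrite addnn mul2n mulnC.
by apply: leq_sum => y _; apply: leq_sum => z _; apply: nat_Cauchy.
Qed.

End Fibers.

(** * Moments recovered from sums of truncated excesses *)

Section Arithmetic.
Local Open Scope nat_scope.

(** With [m = i + 1 - 2 d], the sum is [m + (m - 2) + ...], at least [m^2 / 4]; [i < 2 n] lets the
    range reach every nonzero term. *)
Lemma leq_sqr_sum_excess (i d n : nat) : i < n.*2 ->
  (i.+1 - d.*2) ^ 2 <= 4 * \sum_(d <= j < n) (i.+1 - j.*2).
Proof.
move=> lt_in; have [k le_k] := ubnP (n - d).
elim: k d le_k => // k IH d le_k.
have [le_nd|lt_dn] := leqP n d.
  by have -> : i.+1 - d.*2 = 0 by lia.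
rewrite big_ltn //; have := IH d.+1; move: (\sum_(_ <= _ < _) _) => s.
have -> : i.+1 - d.+1.*2 = i.+1 - d.*2 - 2 by lia.
move: (i.+1 - d.*2) => m /(_ ltac:(lia)).
by case: m => [|[|m]]; nia.
Qed.

(** This combines the closed forms of the sums of squares and cubes, the cubes being moved to the
    left; [2 k <= c] keeps the differences untruncated. *)
Lemma sum_sqr_excess (c k : nat) : k.*2 <= c ->
  6 * (\sum_(1 <= j < k.+1) j ^ 2 * (c - j.*2)) + 3 * (k ^ 2 * k.+1 ^ 2) =
  c * (k * k.+1 * k.*2.+1).
Proof.
elim: k => [|k IH] le_c; first by rewrite big_geq //; lia.
rewrite big_nat_recr //= mulnDr.
have := IH ltac:(lia); move: (\sum_(1 <= _ < _) _) => s.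
have [d ->] : exists d, c = k.+1.*2 + d by exists (c - k.+1.*2); lia.
rewrite addKn => IHs; apply/eqP; rewrite -(eqn_add2r (3 * (k ^ 2 * k.+1 ^ 2))).
have -> : forall a b e f, a + b + e + f = (a + f) + (b + e) by lia.
by rewrite IHs; apply/eqP; rewrite -!mul2n; ring.
Qed.

Lemma leq_pow4_sum_excess (i n : nat) : i < n.*2 ->
  i ^ 3 * i.-1 <= 96 * \sum_(1 <= j < n) j ^ 2 * (i.+1 - j.*2).
Proof.
move=> lt_in.
have [-> //|i0] := posnP i.
pose m := i./2.
have im : m.*2 <= i <= m.*2.+1 by rewrite /m; lia.
(* Cut at [m] with [2 m + 1] for [i + 1], the sum equals [m (m + 1) (m^2 + m + 1) / 6]. *)
have le1 : \sum_(1 <= j < m.+1) j ^ 2 * (m.*2.+1 - j.*2) <=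
    \sum_(1 <= j < n) j ^ 2 * (i.+1 - j.*2).
  rewrite [leqRHS](@big_cat_nat _ _ _ m.+1) //=; last by lia.
  apply: leq_trans (leq_addr _ _); apply: leq_sum => j _.
  by rewrite leq_mul2l; lia.
have := @sum_sqr_excess m.*2.+1 m ltac:(lia).
move: le1; move: (\sum_(1 <= j < n) _) (\sum_(_ <= _ < _) _) => s t le1 Et.
apply: (@leq_trans (m.*2.+1 ^ 3 * m.*2)).
  by apply: leq_mul; [rewrite leq_exp2r|]; lia.
apply: (@leq_trans (96 * t)); last by lia.
nia.
Qed.

(** Telescoping: [1 / j^2 <= 2 (1 / j - 1 / (j + 1))], and these differences sum to at most
    [1 / d]. *)
Lemma leq_sum_inv_sqr (M d n : nat) (x : nat -> nat) : 0 < d ->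
  (forall j, d <= j < n -> j ^ 2 * x j <= M) ->
  d * \sum_(d <= j < n) x j <= 2 * M.
Proof.
move=> d0 xM.
have [le_nd|lt_dn] := leqP n d; first by rewrite big_geq // muln0.
rewrite -(ler_nat rat) natrM natr_sum -ler_pdivlMl ?ltr0n //.
apply: (@le_trans _ _
  (\sum_(d <= j < n) 2 * M%:R * (j%:R^-1 - j.+1%:R^-1) : rat)%R).
  apply: ler_sum_nat => j jd; have j0 : (0 < j%:R :> rat)%R.
    by rewrite ltr0n; lia.
  have := xM j jd; rewrite -(ler_nat rat) natrM natrX => xMj.
  rewrite -(natr1 j).
  have -> : ((j%:R^-1 - (j%:R + 1)^-1) = (j%:R * (j%:R + 1))^-1 :> rat)%R.
    by field; rewrite !lt0r_neq0 // ltr_wpDr.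
  rewrite ler_pdivlMr ?mulr_gt0 ?ltr_wpDr //.
  have j1 : (1 <= j%:R :> rat)%R by rewrite ler1n; lia.
  have x0 : (0 <= (x j)%:R :> rat)%R by [].
  move: (j%:R : rat)%R ((x j)%:R : rat)%R j0 j1 x0 xMj => J y J0 J1 y0 yM.
  have : (0 <= y * J * (J - 1))%R by rewrite !mulr_ge0 ?subr_ge0 // ltW.
  by rewrite !expr2 in yM *; nra.
rewrite -big_distrr /= (telescope_sumr_eq (fun j => - j%:R^-1)%R) => [||j _].
- rewrite opprK addrC natrM mulrC ler_wpM2r ?mulr_ge0 //.
  by rewrite gerBl invr_ge0.
- exact: ltnW.
by rewrite opprK addrC.
Qed.

Lemma exists_cube_root (n : nat) : 0 < n ->
  exists2 d, 0 < d & n <= d ^ 3 <= 8 * n.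
Proof.
move=> n0; have ex : exists d, n <= d ^ 3.
  by exists n; rewrite -{1}(expn1 n) leq_pexp2l.
case: (ex_minnP ex) => -[|d] nd min; first by lia.
exists d.+1 => //; rewrite nd /=.
(* By minimality [d^3 < n], and [d + 1 <= 2 d] unless [d = 0]; hence the factor 8. *)
have := min d; rewrite ltnn => H.
have {}H : d ^ 3 < n by rewrite ltnNge; apply/negP => /H.
by case: d H {nd min} => [|d] H; nia.
Qed.

End Arithmetic.

(** * Collisions, and incidences of lines with a grid *)

Lemma card_leq_collisions (X : finType) (m : nat) (D : {set X})
    (f : X -> 'I_m) :
  #|D| <= m + #|[set p : X * X | [&& p.1 \in D, p.2 \in D, p.1 != p.2
                                   & f p.1 == f p.2]]|.
Proof.
(* [first] keeps the element of least rank in each class of [f], hence at most [m] elements. *)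
pose first := [set x in D | [forall y in D, (f y == f x) ==>
                               (enum_rank x <= enum_rank y)]].
rewrite -(cardsID first D) leq_add //.
  rewrite -[m in _ <= m]card_ord.
  have -> : D :&: first = first.
    by apply/setIidPr/subsetP => x; rewrite inE => /andP[].
  rewrite -(@card_in_imset _ _ f first) ?max_card //.
  move=> x y; rewrite !inE => /andP[xD /forall_inP xf] /andP[yD /forall_inP yf].
  move=> fxy; apply: enum_rank_inj; apply/val_inj/eqP; rewrite eqn_leq.
  by rewrite (implyP (xf y yD)) ?fxy // (implyP (yf x xD)) ?fxy.
(* Any other [x] is charged to a pair [(x, y)] with [y] of smaller rank in its class. *)
pose P x y := [&& y \in D, f y == f x & ~~ (enum_rank x <= enum_rank y)].
pose g x := (x, odflt x [pick y | P x y]).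
rewrite -(@card_imset _ _ g) => [|x y []//].
apply/subset_leq_card/subsetP => _ /imsetP[x + ->].
rewrite !inE => /andP[+ xD]; rewrite xD /= /g /=.
case: pickP => [y /and3P[yD /eqP -> lt] _ |noy].
  by rewrite yD eqxx andbT /=; apply: contra lt => /eqP ->.
case/negP; apply/forall_inP => y yD; apply/implyP => fyx.
by apply: contraFT (noy y); rewrite /P yD fyx.
Qed.

Lemma uniq_count_leq1 (Y : eqType) (s : seq Y) (P : pred Y) : uniq s ->
  (forall y z, P y -> P z -> y = z) -> count P s <= 1.
Proof.
move=> us Peq; rewrite -size_filter.
case E: (filter P s) => [|y [|z s']] //.
have := filter_uniq P us; have : all P (filter P s) by apply: filter_all.
by rewrite E /= => /and3P[Py Pz _]; rewrite (Peq y z) // inE eqxx.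
Qed.

Section Grid.
Variables (R : realFieldType) (T : finType) (v : T -> R).
Hypothesis v_inj : injective v.

Definition incident (g : R * R) (p : T * T) : bool :=
  (v p.2 == g.1 * v p.1 + g.2)%R.

Definition richness (g : R * R) : nat := #|[set p | incident g p]|.

Lemma incident_inj (g : R * R) (p q : T * T) :
  incident g p -> incident g q -> p.1 = q.1 -> p = q.
Proof.
case: p q => [p1 p2] [q1 q2] /eqP /= Ep /eqP /= Eq E.
by congr (_, _) => //; apply: v_inj; rewrite Ep Eq E.
Qed.

Lemma incident_line_unique (g h : R * R) (p q : T * T) : p != q ->
  incident g p -> incident g q -> incident h p -> incident h q -> g = h.
Proof.
move=> pq gp gq hp hq.
have vpq : (v p.1 - v q.1 != 0)%R.
  rewrite subr_eq0; apply: contra pq => /eqP/v_inj E.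
  by apply/eqP; apply: (incident_inj gp gq E).
move: gp gq hp hq => /eqP gp /eqP gq /eqP hp /eqP hq.
have E1 : g.1 = h.1.
  apply: (mulIf vpq).
  have := congr2 (fun x y => x - y)%R
    (etrans (esym gp) hp) (etrans (esym gq) hq).
  lra.
rewrite [g]surjective_pairing [h]surjective_pairing E1.
by congr (_, _); move: gp; rewrite hp E1 => /addrI.
Qed.

Lemma richness_max (g : R * R) : richness g <= #|T|.
Proof.
rewrite /richness -(@card_in_imset _ _ (fun p : T * T => p.1)) ?max_card //.
by move=> p q; rewrite !inE; apply: incident_inj.
Qed.

Definition grid_rank (x : T) : nat := #|[set y | (v y < v x)%R]|.

Lemma grid_rank_ltn (x : T) : grid_rank x < #|T|.
Proof.
rewrite /grid_rank -cardsT; apply: proper_card.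
by apply/properP; split; [apply: subsetT | exists x; rewrite ?inE ?ltxx].
Qed.

Lemma leq_grid_rank (x y : T) : (v x <= v y)%R -> grid_rank x <= grid_rank y.
Proof.
move=> xy; apply/subset_leq_card/subsetP => z.
by rewrite !inE => /lt_le_trans -> .
Qed.

Lemma grid_rank_inj : injective grid_rank.
Proof.
have H x y : (v x < v y)%R -> grid_rank x < grid_rank y.
  move=> xy; apply: proper_card; apply/properP; split.
    by apply/subsetP => z; rewrite !inE => /lt_trans ->.
  by exists x; rewrite inE ?ltxx.
move=> x y E; apply: v_inj.
by have [/H|/H|//] := ltgtP (v x) (v y); rewrite E ltnn.
Qed.

(** Blocks of ranks rather than of values: each holds at most [b] elements whatever the spacing of
    [v]. *)
Definition cell (b : nat) (x : T) : nat := grid_rank x %/ b.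

Lemma leq_cell (b : nat) (x y : T) : (v x <= v y)%R -> cell b x <= cell b y.
Proof. by move=> xy; apply/leq_div2r/leq_grid_rank. Qed.

Lemma ltn_cell (b j : nat) (x : T) : #|T| <= j * b -> cell b x < j.
Proof.
move=> Tjb; have lt : grid_rank x < j * b := leq_trans (grid_rank_ltn x) Tjb.
by rewrite ltn_divLR //; case: b lt {Tjb} => //; rewrite muln0.
Qed.

Lemma card_cell (b : nat) (x : T) : 0 < b ->
  #|[set y | cell b y == cell b x]| <= b.
Proof.
move=> b0; rewrite -[b in _ <= b]card_ord.
pose f y := Ordinal (ltn_pmod (grid_rank y) b0).
rewrite -(@card_in_imset _ _ f) ?max_card // => y z.
rewrite !inE => /eqP yx /eqP zx [E]; apply: grid_rank_inj.
rewrite (divn_eq (grid_rank y) b) (divn_eq (grid_rank z) b) E.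
by rewrite -/(cell b y) yx -zx.
Qed.

Definition same_cell (b : nat) (p q : T * T) : bool :=
  (cell b p.1 == cell b q.1) && (cell b p.2 == cell b q.2).

(* A line that is not horizontal is a monotone curve, so it meets at most
   [2 j - 1] of the [j ^ 2] cells. *)
Lemma richness_leq_same_cell (b j : nat) (g : R * R) :
  g.1 != 0%R -> 0 < j -> #|T| <= j * b ->
  richness g <= j.*2.-1 + #|[set p : (T * T) * (T * T) |
    [&& incident g p.1, incident g p.2, p.1 != p.2 & same_cell b p.1 p.2]]|.
Proof.
move=> g1 j0 Tjb.
(* Reversing the second index on a falling line makes both summands weakly increasing along [g], so
   equal [u] forces equal cells. *)
pose u (p : T * T) : nat := if (0 < g.1)%R then cell b p.1 + cell b p.2
           else cell b p.1 + (j.-1 - cell b p.2).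
have u_lt p : u p < j.*2.-1.
  rewrite /u; have := ltn_cell p.1 Tjb; have := ltn_cell p.2 Tjb.
  by case: ifP => _; lia.
have := @card_leq_collisions _ _ [set p | incident g p]
  (fun p => Ordinal (u_lt p)).
rewrite -/(richness g) => /leq_trans; apply; rewrite leq_add2l.
apply/subset_leq_card/subsetP => -[p q]; rewrite !inE /= => /and4P[gp gq pq].
rewrite gp gq pq /= -val_eqE /= /u /same_cell.
wlog le_pq : p q gp gq {pq} / (v p.1 <= v q.1)%R.
  move=> W; have [|/ltW le] := leP (v p.1) (v q.1); first exact: W.
  rewrite eq_sym => /(W _ _ gq gp le).
  by rewrite eq_sym [X in _ && X]eq_sym.
have c1 := leq_cell b le_pq.
move: (gp) (gq) => /eqP Ep /eqP Eq.
have := ltn_cell p.2 Tjb; have := ltn_cell q.2 Tjb.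
have [g0 _ _|g0 _ _] := ltP 0%R g.1.
  have c2 : cell b p.2 <= cell b q.2.
    by apply: leq_cell; rewrite Ep Eq lerD2r ler_pM2l.
  by lia.
have c2 : cell b q.2 <= cell b p.2.
  by apply: leq_cell; rewrite Ep Eq lerD2r ler_nM2l // lt_neqAle g1.
have := ltn_cell p.2 Tjb; have := ltn_cell q.2 Tjb.
by lia.
Qed.

Lemma card_same_cell (b : nat) : 0 < b ->
  #|[set p : (T * T) * (T * T) | same_cell b p.1 p.2]| <= #|T| ^ 2 * b ^ 2.
Proof.
move=> b0; rewrite -sum1_card big_mkcond /=.
under eq_bigr => p _ do rewrite inE.
rewrite -(pair_bigA _ (fun p q => if same_cell b p q then 1 else 0)) /=.
rewrite -mulnn -card_prod -sum_nat_const; apply: leq_sum => p _.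
rewrite -big_mkcond sum1_card /=.
apply: (@leq_trans #|setX [set y | cell b y == cell b p.1]
                          [set y | cell b y == cell b p.2]|).
  apply/subset_leq_card/subsetP => -[q1 q2]; rewrite !inE unfold_in /same_cell /=.
  by rewrite eq_sym [cell b p.2 == _]eq_sym.
by rewrite cardsX -mulnn leq_mul ?card_cell.
Qed.

(* Szemeredi-Trotter for a Cartesian square: two points in a common cell
   determine at most one line of [G]. *)
Lemma sum_excess_leq (G : seq (R * R)) (j : nat) :
  uniq G -> {in G, forall g, g.1 != 0%R} -> 0 < j -> j <= #|T| ->
  j ^ 2 * (\sum_(g <- G) ((richness g).+1 - j.*2)) <= 4 * #|T| ^ 4.
Proof.
(* With this width [j] blocks cover [T], while [j b <= 2 |T|] because [j <= |T|]; this gives the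
   constant 4. *)
move=> uG G1 j0 jT; pose b := (#|T| %/ j).+1.
have Tjb : #|T| <= j * b <= 2 * #|T|.
  rewrite /b mulnS mulnC; have := divn_eq #|T| j; have := ltn_pmod #|T| j0.
  by move: (_ %/ _) (_ %% _) => ? ?; nia.
have {Tjb} [Tjb jbT] := andP Tjb.
suff le : \sum_(g <- G) ((richness g).+1 - j.*2) <= #|T| ^ 2 * b ^ 2.
  apply: (@leq_trans (#|T| ^ 2 * (j * b) ^ 2)).
    by rewrite expnMn mulnCA leq_mul2l le orbT.
  apply: (@leq_trans (#|T| ^ 2 * (2 * #|T|) ^ 2)).
    by rewrite leq_mul2l leq_exp2r // jbT orbT.
  by apply: eq_leq; ring.
pose P (g : R * R) (p : (T * T) * (T * T)) :=
  [&& incident g p.1, incident g p.2 & p.1 != p.2].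
pose K := [set p : (T * T) * (T * T) | same_cell b p.1 p.2].
apply: (leq_trans _ (card_same_cell (ltn0Sn _ : 0 < b))).
apply: (@leq_trans (\sum_(g <- G) \sum_(p in K) P g p)).
  rewrite big_seq [leqRHS]big_seq; apply: leq_sum => g gG.
  have := richness_leq_same_cell (G1 g gG) j0 Tjb.
  have -> : #|[set p : (T * T) * (T * T) | [&& incident g p.1, incident g p.2,
      p.1 != p.2 & same_cell b p.1 p.2]]| = \sum_(p in K) P g p.
    rewrite -big_mkcondr /= -sum1_card; apply: eq_bigl => p.
    by rewrite !inE [RHS]andbC -!andbA.
  by lia.
rewrite exchange_big /= -sum1_card; apply: leq_sum => p _.
rewrite -big_mkcond /= sum1_count; apply: uniq_count_leq1 => // g h.
by move=> /and3P[gp gq pq] /and3P[hp hq _]; apply: (incident_line_unique pq).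
Qed.

End Grid.

(** * Energy of the quotient lines, and the number of values *)

Lemma card_sum_slices (X Y : finType) (D : {set X}) (S : X -> {set Y}) :
  \sum_(x in D) #|S x| = #|[set p : X * Y | (p.1 \in D) && (p.2 \in S p.1)]|.
Proof.
under eq_bigr => x _ do rewrite -sum1_card.
by rewrite pair_big_dep /= -sum1_card; apply: eq_bigl => p; rewrite !inE.
Qed.

Lemma leq_sum_slices (X Y X' Y' : finType) (D : {set X}) (S : X -> {set Y})
    (D' : {set X'}) (S' : X' -> {set Y'}) (f : X * Y -> X' * Y') :
  injective f ->
  (forall x y, x \in D -> y \in S x ->
     (f (x, y)).1 \in D' /\ (f (x, y)).2 \in S' (f (x, y)).1) ->
  \sum_(x in D) #|S x| <= \sum_(x in D') #|S' x|.
Proof.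
move=> f_inj fS; rewrite !card_sum_slices -(card_imset _ f_inj).
apply/subset_leq_card/subsetP => _ /imsetP[[x y] + ->].
by rewrite !inE => /andP[xD yS]; apply/andP/fS.
Qed.

Section Energy.
Variables (R : realFieldType) (T : finType) (v : T -> R).
Hypothesis v_inj : injective v.

Definition offdiag : {set T * T} := [set p | p.1 != p.2].

Lemma offdiag_subr_neq0 (p : T * T) :
  p \in offdiag -> (v p.1 - v p.2 != 0)%R.
Proof. by rewrite inE subr_eq0 (inj_eq v_inj). Qed.

Lemma card_offdiag : #|offdiag| = #|T| * #|T|.-1.
Proof.
have -> : offdiag = [set p | (p.1 \in [set: T]) && (p.2 \in [set~ p.1])].
  by apply/setP => p; rewrite !inE eq_sym.
rewrite -(card_sum_slices setT (fun x => [set~ x])) (eq_bigr (fun=> #|T|.-1)) => [|x _].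
  by rewrite sum_nat_const cardsT.
by rewrite cardsC1.
Qed.

Definition offdiag2 := setX offdiag offdiag.

Lemma card_offdiag2 : #|offdiag2| <= #|T| ^ 4.
Proof.
rewrite cardsX card_offdiag.
have : #|T| * #|T|.-1 <= #|T| ^ 2 by rewrite -mulnn leq_mul2l leq_pred orbT.
by move=> le; apply: leq_trans (leq_mul le le) _; rewrite -expnD.
Qed.

(* The line [(a1, a2)] is the graph of [x |-> (a1 - a2) x + a1];
   [quotient_line (l, l')] is the composition of [l] with the inverse of [l']. *)
Definition line_eval (z : (T * T) * T) : R :=
  ((v z.1.1 - v z.1.2) * v z.2 + v z.1.1)%R.

Definition quotient_line (q : (T * T) * (T * T)) : R * R :=
  ((v q.1.1 - v q.1.2) / (v q.2.1 - v q.2.2),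
   (v q.1.1 - v q.2.1) / (v q.2.1 - v q.2.2))%R.

(** The line through the grid points [(q.1.1, q.2.1)] and [(q.1.2, q.2.2)]: abscissae come from
    [q.1], ordinates from [q.2]. *)
Definition joining_line (q : (T * T) * (T * T)) : R * R :=
  let s := ((v q.2.1 - v q.2.2) / (v q.1.1 - v q.1.2))%R in
  (s, v q.2.1 - s * v q.1.1)%R.

Lemma values_slope_neq0 (f : (T * T) * (T * T) -> R * R) :
  {in offdiag2, forall q, (f q).1 != 0%R} ->
  {in values offdiag2 f, forall g, g.1 != 0%R}.
Proof. by move=> f0 g; rewrite mem_undup => /imageP[q /f0 + ->]. Qed.

Lemma quotient_line_slope :
  {in offdiag2, forall q, (quotient_line q).1 != 0%R}.
Proof.
move=> [l m] /setXP[/offdiag_subr_neq0 l0 /offdiag_subr_neq0 m0].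
by rewrite mulf_neq0 ?invr_eq0.
Qed.

Lemma joining_line_slope :
  {in offdiag2, forall q, (joining_line q).1 != 0%R}.
Proof.
move=> [l m] /setXP[/offdiag_subr_neq0 l0 /offdiag_subr_neq0 m0].
by rewrite mulf_neq0 ?invr_eq0.
Qed.

Lemma joining_line_incident (q : (T * T) * (T * T)) : q \in offdiag2 ->
  incident v (joining_line q) (q.1.1, q.2.1) /\
  incident v (joining_line q) (q.1.2, q.2.2).
Proof.
case: q => l m /setXP[/offdiag_subr_neq0 l0 _].
by split; apply/eqP => /=; field.
Qed.

Lemma card_fiber_joining_line (h : R * R) :
  #|fiber offdiag2 joining_line h| <= richness v h * (richness v h).-1.
Proof.
pose X := [set p | incident v h p].
apply: (@leq_trans (\sum_(p in X) #|X :\ p|)); last first.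
  rewrite -sum_nat_const; apply: eq_leq; apply: eq_bigr => p pX.
  by rewrite /richness -/X (cardsD1 p X) pX.
rewrite card_sum_slices.
pose f (q : (T * T) * (T * T)) := ((q.1.1, q.2.1), (q.1.2, q.2.2)).
have f_inj : injective f by move=> [[? ?] [? ?]] [[? ?] [? ?]] [-> -> -> ->].
rewrite -[leqLHS](card_imset _ f_inj).
apply/subset_leq_card/subsetP => _ /imsetP[q + ->].
rewrite mem_fiber => /andP[qQ /eqP qh]; have [i1 i2] := joining_line_incident qQ.
rewrite /X !inE /= -qh i1 i2 andbT /=.
case: q qQ {qh i1 i2} => l m /setXP[+ _]; rewrite inE; apply: contra => /eqP[-> _].
by [].
Qed.

(** A line of richness [i] joins at most [i (i - 1)] pairs, so the sum is at most that of
    [i^3 (i - 1)] over lines. Each of the [|T|] layers [j] costs [4 |T|^4], and [384 = 96 * 4]. *)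
Lemma sum_sqr_richness_joining_line :
  \sum_(q in offdiag2) richness v (joining_line q) ^ 2 <= 384 * #|T| ^ 5.
Proof.
rewrite (sum_fiber offdiag2 joining_line (fun h => richness v h ^ 2)).
set H := values _ _.
apply: (@leq_trans (\sum_(h <- H) 96 *
  \sum_(1 <= j < #|T|.+1) j ^ 2 * ((richness v h).+1 - j.*2))).
  apply: leq_sum => h _.
  apply: leq_trans (leq_pow4_sum_excess (n := #|T|.+1) _); last first.
    by have := richness_max v_inj h; lia.
  apply: leq_trans (leq_mul (card_fiber_joining_line h) (leqnn _)) _.
  by apply: eq_leq; ring.
rewrite -big_distrr exchange_big /=.
apply: (@leq_trans (96 * \sum_(1 <= j < #|T|.+1) 4 * #|T| ^ 4)); last first.
  by rewrite sum_nat_const_nat; apply: eq_leq; rewrite subn1 /=; ring.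
rewrite leq_mul2l /= big_nat [leqRHS]big_nat; apply: leq_sum => j /andP[j0 jT].
rewrite -big_distrr /=; apply: sum_excess_leq => //; first exact: undup_uniq.
exact/values_slope_neq0/joining_line_slope.
Qed.

(* If the quotients of [(l, l')] and [(m, m')] coincide, then
   [(l'.1, m'.1)], [(l'.2, m'.2)], [(l.1, m.1)] and [(l.2, m.2)] are collinear. *)
Lemma quotient_line_energy :
  \sum_(g <- values offdiag2 quotient_line)
     #|fiber offdiag2 quotient_line g| ^ 2 <= 384 * #|T| ^ 5.
Proof.
under eq_bigr => g _ do rewrite -mulnn.
rewrite -(sum_fiber _ _ (fun g => #|fiber offdiag2 quotient_line g|)).
apply: leq_trans sum_sqr_richness_joining_line.
pose S q := setX [set p | incident v (joining_line q) p]
                 [set p | incident v (joining_line q) p].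
rewrite [leqRHS](eq_bigr (fun q => #|S q|)); last first.
  by move=> q _; rewrite cardsX mulnn.
(* [(l', m')] selects the line; [(l.1, m.1)] and [(l.2, m.2)] are two points on it. *)
pose f (z : ((T * T) * (T * T)) * ((T * T) * (T * T))) :=
  ((z.1.2, z.2.2), ((z.1.1.1, z.2.1.1), (z.1.1.2, z.2.1.2))).
apply: (@leq_sum_slices _ _ _ _ _ _ _ _ f).
  move=> [[[? ?] [? ?]] [[? ?] [? ?]]] [[[? ?] [? ?]] [[? ?] [? ?]]].
  by move=> [-> -> -> -> -> -> -> ->].
move=> [[l1 l2] [l1' l2']] [[m1 m2] [m1' m2']] /setXP[_ l'].
rewrite mem_fiber => /andP[/setXP[_ m'] /eqP []] /= E1 E2.
split; first by apply/setXP.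
have /= vl := offdiag_subr_neq0 l'; have /= vm := offdiag_subr_neq0 m'.
rewrite !inE /incident /=.
have F1 : (v m1 - v m1' = (v m1' - v m2') / (v l1' - v l2') * (v l1 - v l1'))%R.
  by rewrite -mulrA [X in (_ * X)%R]mulrC -E2; field.
have F2 : (v m1 - v m2 = (v m1' - v m2') / (v l1' - v l2') * (v l1 - v l2))%R.
  by rewrite -mulrA [X in (_ * X)%R]mulrC -E1; field.
move: (_ / _)%R F1 F2 => s F1 F2.
by apply/andP; split; apply/eqP; lra.
Qed.

Lemma sum_richness_quotient_line (d : nat) : 0 < d ->
  2 * d ^ 2 * \sum_(q in offdiag2) richness v (quotient_line q) <=
  384 * #|T| ^ 5 + 36 * d ^ 3 * #|T| ^ 4.
Proof.
move=> d0.
pose w g := (richness v g).+1 - d.*2.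
pose G := values offdiag2 quotient_line.
pose r g := #|fiber offdiag2 quotient_line g|.
(* [32 = 4 * 2 * 4]: squares into layers, the telescoping sum, and the incidence bound. *)
have W : d * \sum_(g <- G) w g ^ 2 <= 32 * #|T| ^ 4.
  apply: (@leq_trans (4 * (d * \sum_(d <= j < #|T|.+1)
      \sum_(g <- G) ((richness v g).+1 - j.*2)))).
    rewrite mulnCA leq_mul2l exchange_big /= big_distrr /=.
    apply/orP; right; apply: leq_sum => g _.
    apply: leq_sqr_sum_excess.
    apply: leq_ltn_trans (richness_max v_inj g) _.
    by rewrite -addnn ltnS leq_addr.
  suff le : d * \sum_(d <= j < #|T|.+1)
      \sum_(g <- G) ((richness v g).+1 - j.*2) <= 2 * (4 * #|T| ^ 4).
    by apply: leq_trans (leq_mul (leqnn 4) le) _; rewrite !mulnA.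
  apply: leq_sum_inv_sqr => // j /andP[dj jT].
  apply: sum_excess_leq => //; first exact: undup_uniq.
    exact/values_slope_neq0/quotient_line_slope.
  exact: leq_trans dj.
(* AM-GM is applied to [r g] and [d^2 * w g], a weight that balances the two second moments. *)
have RW : 2 * d ^ 2 * \sum_(g <- G) r g * w g <=
    \sum_(g <- G) r g ^ 2 + d ^ 4 * \sum_(g <- G) w g ^ 2.
  rewrite !big_distrr -big_split /=; apply: leq_sum => g _.
  have := nat_Cauchy (r g) (d ^ 2 * w g).
  by rewrite expnMn -expnM; apply: leq_trans; apply: eq_leq; ring.
have S : \sum_(q in offdiag2) richness v (quotient_line q) <=
    2 * d * #|T| ^ 4 + \sum_(g <- G) r g * w g.
  rewrite -(sum_fiber _ _ w).
  apply: (@leq_trans (\sum_(q in offdiag2) (2 * d + w (quotient_line q)))).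
    by apply: leq_sum => q _; rewrite /w; lia.
  rewrite big_split /= leq_add2r sum_nat_const mulnC leq_mul2l card_offdiag2.
  by rewrite orbT.
have := quotient_line_energy; rewrite -/G.
move: W RW S; rewrite -/r.
move: (\sum_(g <- G) w g ^ 2) (\sum_(g <- G) r g * w g) => W RW.
move: (\sum_(g <- G) #|_| ^ 2) (\sum_(q in _) _) => E S.
move=> leW leRW leS leE.
apply: (leq_trans (leq_mul (leqnn _) leS)); rewrite mulnDr.
have : d ^ 4 * W <= 32 * d ^ 3 * #|T| ^ 4.
  have -> : d ^ 4 * W = d ^ 3 * (d * W) by ring.
  by rewrite [32 * _]mulnC -mulnA leq_mul2l leW orbT.
have -> : 2 * d ^ 2 * (2 * d * #|T| ^ 4) = 4 * d ^ 3 * #|T| ^ 4 by ring.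
by lia.
Qed.

Definition line_points : {set (T * T) * T} := setX offdiag [set: T].

(** A collision [l x = l' y] says that [(x, y)] lies on the quotient line of [(l, l')]. *)
Lemma sum_card_fiber_line_eval :
  \sum_(z in line_points) #|fiber line_points line_eval (line_eval z)| <=
  \sum_(q in offdiag2) richness v (quotient_line q).
Proof.
pose f (z : ((T * T) * T) * ((T * T) * T)) :=
  ((z.1.1, z.2.1), (z.1.2, z.2.2)).
apply: (@leq_sum_slices _ _ _ _ _ _ _ _ f).
  by move=> [[[? ?] ?] [[? ?] ?]] [[[? ?] ?] [[? ?] ?]] [-> -> -> -> -> ->].
move=> [[a1 a2] x] [[b1 b2] y] /setXP[la _].
rewrite mem_fiber => /andP[/setXP[lb _] /eqP E]; split; first by apply/setXP.
have /= vb := offdiag_subr_neq0 lb.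
rewrite inE /incident /=; apply/eqP; apply: (mulfI vb).
move: E; rewrite /line_eval /= => E.
transitivity ((v a1 - v a2) * v x + v a1 - v b1)%R; last by field.
by rewrite -E; ring.
Qed.

Lemma card_line_values : 1 < #|T| ->
  #|T| ^ 5 <= (1344 * size (values line_points line_eval)) ^ 3.
Proof.
move=> T1; have [d d0 /andP[Td dT]] := exists_cube_root (ltnW T1).
have := fiber_CauchySchwarz line_points line_eval.
have := sum_card_fiber_line_eval; have := sum_richness_quotient_line d0.
rewrite [#|line_points|]cardsX card_offdiag cardsT.
move: (size _) (\sum_(z in line_points) _) (\sum_(q in offdiag2) _) => V S' S.
move: #|T| T1 Td dT => N N1 Nd dN leS S'S CS.
(* As [d^3 <= 8 N], both terms are of order [N^5]: [672 = 384 + 36 * 8]. *)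
have {}leS : 2 * d ^ 2 * S' <= 672 * N ^ 5.
  apply: (leq_trans (leq_mul (leqnn _) S'S)); apply: (leq_trans leS).
  have := leq_mul dN (leqnn (36 * N ^ 4)).
  have -> : 8 * N * (36 * N ^ 4) = 288 * N ^ 5 by ring.
  have -> : d ^ 3 * (36 * N ^ 4) = 36 * d ^ 3 * N ^ 4 by ring.
  by lia.
have N6 : N ^ 6 <= 4 * (N * N.-1 * N) ^ 2.
  have -> : N ^ 6 = N ^ 4 * N ^ 2 by ring.
  have -> : 4 * (N * N.-1 * N) ^ 2 = N ^ 4 * (2 * N.-1) ^ 2 by ring.
  by rewrite leq_mul2l leq_exp2r //; lia.
have main : d ^ 2 * N <= 1344 * V.
  have N5 : 0 < 2 * N ^ 5 by rewrite muln_gt0 expn_gt0; lia.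
  rewrite -(leq_pmul2l N5).
  have -> : 2 * N ^ 5 * (d ^ 2 * N) = 2 * d ^ 2 * N ^ 6 by ring.
  apply: (leq_trans (leq_mul (leqnn _) N6)).
  apply: (leq_trans (leq_mul (leqnn _) (leq_mul (leqnn _) CS))).
  have -> : 2 * d ^ 2 * (4 * (V * S')) = 4 * V * (2 * d ^ 2 * S') by ring.
  apply: (leq_trans (leq_mul (leqnn _) leS)).
  by apply: eq_leq; ring.
apply: (@leq_trans ((d ^ 2 * N) ^ 3)); last by rewrite leq_exp2r.
have -> : (d ^ 2 * N) ^ 3 = (d ^ 3) ^ 2 * N ^ 3 by ring.
have -> : N ^ 5 = N ^ 2 * N ^ 3 by ring.
by rewrite leq_mul2r leq_exp2r // Nd orbT.
Qed.

End Energy.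

Local Open Scope fset_scope.
Local Open Scope ring_scope.

Theorem theorem13 (R : realType) :
  exists2 c : R, 0 < c &
    forall A : {fset R},
      c * (#|` A|%:R `^ (5%:R / 3%:R)) <= #|` expander_set A|%:R :> R.
Proof.
exists 1344%:R^-1; first by rewrite invr_gt0.
move=> A; rewrite ler_pdivrMl //.
set B := expander_set A.
(* Cubing the claim clears the fractional exponent. *)
suff le : (#|` A| ^ 5 <= (1344 * #|` B|) ^ 3)%N.
  rewrite powRrM powR_mulrn // -natrX.
  apply: (@le_trans _ _ (((1344 * #|` B|) ^ 3)%N%:R `^ 3%:R^-1)).
    by rewrite ge0_ler_powR ?nnegrE ?ler_nat // invr_ge0.
  by rewrite natrX -powR_mulrn // -powRrM divff ?pnatr_eq0 // powRr1 // natrM.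
(* A set with at most one element has no off-diagonal pair and is treated directly. *)
have [A1|] := ltnP 1 #|` A|; last first.
  case E : #|` A| => [|[|//]] _ //.
  have /fset0Pn[a aA] : A != fset0 by rewrite -cardfs_gt0 E.
  have : (0 < #|` B|)%N.
    rewrite cardfs_gt0; apply/fset0Pn; exists ((a - a) * a + a).
    by apply/expander_setP; exists a, a, a.
  by rewrite exp1n expn_gt0 muln_gt0 => ->.
rewrite !cardfE in A1 *.
apply: (leq_trans (card_line_values (v := fun x : A => val x) val_inj A1)).
rewrite leq_exp2r // leq_mul2l /= -cardfE.
apply: uniq_leq_size; first exact: undup_uniq.
move=> x; rewrite mem_undup => /imageP[[[a1 a2] a3] _ ->] /=.
apply/expander_setP; exists (val a1), (val a2), (val a3).
by split=> //; apply: valP.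
Qed.
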